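(* Let $\mathcal H,\mathcal G$ be separable Hilbert spaces, let $K\colon\mathcal H\to\mathcal G$ be a contraction, and put $$S:=K^*K,\qquad W:=(I_{\mathcal G}-KK^* )^{1/2},\qquad R:=WK.$$ Fix $0<\epsilon<1/2$. Suppose that $N\in\mathbb N_0$, that $K_N\colon\mathcal H\to\mathcal G$ has rank at most $N$, and that $K-K_N$ is Hilbert--Schmidt. Define $$e_N^2:=\|K-K_N\|_{\mathcal S_2}^2,\qquad d_N^2:=\|W(K-K_N)\|_{\mathcal S_2}^2.$$ Then $$Q_\epsilon(S):=\operatorname{rank}\mathbf 1_{(\epsilon,\infty)}(S)\le N+\kappa\!\left(\frac{e_N^2}{\epsilon}\right),$$ $$\Lambda_\epsilon(S)\le\min\left\{N+\kappa\!\left(\frac{e_N^2}{\epsilon}\right),\;N+\kappa\!\left(\frac{d_N^2}{\epsilon(1-\epsilon)}\right)\right\}.$$ Moreover, $$d_N^2=\operatorname{Tr}\!\left((K-K_N)^*(I-KK^* )(K-K_N)\right)\le e_N^2.$$ The upper bounds for $Q_\epsilon(S)$ and $\Lambda_\epsilon(S)$ may be minimized over every available $N\in\mathbb N_0$ and every available operator $K_N\colon\mathcal H\to\mathcal G$ of rank at most $N$ such that $K-K_N$ is Hilbert--Schmidt.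
   Context: For a positive contraction $S$, $\Lambda_\epsilon(S):=\operatorname{rank}\mathbf 1_{(\epsilon,1-\epsilon)}(S)$ (spectral projection for the open interval). $\|\cdot\|_{\mathcal S_2}$ is the Hilbert--Schmidt norm. For $r\ge0$, $\kappa(r):=\max\{0,\lceil r\rceil-1\}$. *)

(* Defs.v *)
From HB Require Import structures.
From mathcomp Require Import all_boot all_order all_algebra.
From mathcomp Require Import complex.
From mathcomp Require Import all_classical all_reals all_analysis.

Set Implicit Arguments.
Unset Strict Implicit.
Unset Printing Implicit Defensive.

Import Order.TTheory GRing.Theory Num.Theory.
Import numFieldNormedType.Exports.

Local Open Scope classical_set_scope.
Local Open Scope ring_scope.
Local Open Scope complex_scope.

(* Complex Hilbert spaces.  [inner] is linear in its first argument and
   conjugate-linear in its second one.  The norm of a normed module over R[i]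
   takes its values in R[i]. *)
HB.mixin Record isHilbert (R : realType) H of CompleteNormedModule R[i] H := {
  inner : {dot H for (@Num.conj R[i])} ;
  inner_norm : forall x : H, inner x x = `|x| ^+ 2
}.

#[short(type="hilbertType")]
HB.structure Definition Hilbert (R : realType) :=
  { H of isHilbert R H & CompleteNormedModule R[i] H }.

Definition separable (T : topologicalType) : Prop :=
  exists2 D : set T, countable D & dense D.

Section operators.
Context {R : realType}.
Implicit Types H G : hilbertType R.

Definition bounded_op H G (T : H -> G) : Prop := linear T /\ continuous T.

Definition contraction_op H G (T : H -> G) : Prop :=
  linear T /\ forall x, `|T x| <= `|x|.

(* For T bounded, the set below is a singleton (Riesz). *)
Definition adjoint H G (T : H -> G) (y : G) : H :=
  xget 0 [set z | forall x, inner (T x) y = inner x z].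

(* In R[i], [0 <= z] says that z is real and nonnegative; on a complex Hilbert
   space a bounded positive operator is therefore self-adjoint. *)
Definition positive_op H (T : H -> H) : Prop :=
  forall x, 0 <= inner (T x) x.

(* For A bounded and positive, the set below is a singleton. *)
Definition op_sqrt H (A : H -> H) : H -> H :=
  xget (fun=> 0) [set B | [/\ bounded_op B, positive_op B & B \o B = A]].

Definition lin_free H n (v : 'I_n -> H) : Prop :=
  forall c : 'I_n -> R[i], \sum_i c i *: v i = 0 -> forall i, c i = 0.

(* Dimension of the range, +oo when it is infinite. *)
Definition op_rank H G (T : H -> G) : \bar R :=
  ereal_sup [set (n%:R)%:E | n in
    [set n : nat | exists v : 'I_n -> H, lin_free (T \o v)]].

Definition orthonormal_set H (B : set H) : Prop :=
  (forall x, B x -> inner x x = 1) /\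
  (forall x y, B x -> B y -> x <> y -> inner x y = 0).

Definition orthonormal_basis H (B : set H) : Prop :=
  orthonormal_set B /\
  (forall x, (forall b, B b -> inner x b = 0) -> x = 0).

(* A fixed orthonormal basis; neither [hs_normsq] nor, on positive operators,
   [trace_pos] depends on which one is taken. *)
Definition onb H : set H := xget set0 [set B | orthonormal_basis B].
Arguments onb H : clear implicits.

(* Square of the Hilbert-Schmidt norm, in [0, +oo]. *)
Definition hs_normsq H G (T : H -> G) : \bar R :=
  \esum_(e in onb H) (complex.Re (`|T e| ^+ 2))%:E.

Definition hilbert_schmidt H G (T : H -> G) : Prop :=
  bounded_op T /\ (hs_normsq T < +oo)%E.

(* Trace, in [0, +oo], of a positive operator. *)
Definition trace_pos H (T : H -> H) : \bar R :=
  \esum_(e in onb H) (complex.Re (inner (T e) e))%:E.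

Definition orthogonal_projection H (P : H -> H) : Prop :=
  [/\ bounded_op P, P \o P = P & forall x y, inner (P x) y = inner x (P y)].

(* E is a projection-valued measure on the Borel sets of R and
   S = \int t dE(t).  Countable additivity of E is expressed by requiring the
   set functions <E(.)x, x> to be measures, and the integral is taken in the
   weak sense; by polarization the diagonal forms are enough. *)
Definition is_spectral_measure H (S : H -> H) (E : set R -> H -> H) : Prop :=
  [/\ forall A, measurable A -> orthogonal_projection (E A),
      E setT = id,
      forall A B, measurable A -> measurable B -> E (A `&` B) = E A \o E B
    & forall x, exists mu : {measure set (measurableTypeR R) -> \bar R},
        [/\ forall A, measurable A -> mu A = (complex.Re (inner (E A x) x))%:E,
            mu.-integrable setT (fun t => t%:E)
          & inner (S x) x = (\int[mu]_t t)%:C ] ].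

(* By the spectral theorem a bounded self-adjoint S has a spectral measure, and
   only one on Borel sets, so the default value plays no role for such S. *)
Definition spectral_measure H (S : H -> H) : set R -> H -> H :=
  xget (fun _ _ => 0) [set E | is_spectral_measure S E].

Definition spectral_proj H (A : set R) (S : H -> H) : H -> H :=
  spectral_measure S A.

Definition Qrank H (eps : R) (S : H -> H) : \bar R :=
  op_rank (spectral_proj `]eps, +oo[ S).

Definition Lambda H (eps : R) (S : H -> H) : \bar R :=
  op_rank (spectral_proj `]eps, (1 - eps)[ S).

End operators.

Definition kappa {R : realType} (r : R) : int := Num.max 0 (Num.ceil r - 1).

(* Main.v *)
(** Let [P] be the spectral projection onto [(eps, +oo)].  If [range P] contains
    an [(N + k)]-dimensional subspace, that subspace meets [ker KN] in dimension
    at least [k].  For an orthonormal family [u_1, .., u_k] there,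
    [eps < <S u_i, u_i> = |K u_i|^2 = |(K - KN) u_i|^2], so
    [k * eps < e_N^2]; strictness is what allows [kappa] instead of a floor.  On
    the range of the projection onto [(eps, 1 - eps)] the same argument applies
    to [W (K - KN)], since there
    [eps (1 - eps) |u|^2 < <(S - S^2) u, u> = |W K u|^2]. *)

Require Import Defs.
From HB Require Import structures.
From mathcomp Require Import all_boot all_order all_algebra.
From mathcomp Require Import complex ring lra.
From mathcomp Require Import all_classical all_reals all_analysis.
Set Implicit Arguments.
Unset Strict Implicit.
Import Order.TTheory GRing.Theory Num.Theory.
Import numFieldNormedType.Exports.
Local Open Scope classical_set_scope.
Local Open Scope ring_scope.
Local Open Scope complex_scope.

(** * Norm and inner product *)

(** The spectral measure is accessible only through the diagonal forms [<S x, x>], and this shapes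
    the second bound. A strict bound on [<S u, u>] comes from integrating a positive function
    against the measure of [u], but [|S u|^2] is not given as such an integral. So [S] is shown to
    preserve the range of the projection, and the bound on [S - S^2] is reduced to first-order
    bounds at the vectors [(S - a) u] and [(b - S) u], with [a = eps] and [b = 1 - eps]. The
    identity [|W y|^2 = |y|^2 - |K^* y|^2] at [y = K u] then brings in [W]. The adjoint, the square
    root and the basis are chosen by [xget], so their properties rest on existence: by Riesz, by an
    iteration dominated by a scalar one, and by Zorn. The dimension count goes through the rank of a
    Gram matrix. *)

Section real_norm.
Context {R : realType}.
Implicit Types (H : hilbertType R) (a b : R[i]).

Definition rnorm {H} (x : H) : R := complex.Re `|x|.

(* On the real part, bilinearity turns norm computations into goals that
   [ring], [lra] and [nra] can process. *)
Definition rinner {H} (x y : H) : R := complex.Re (inner x y).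

Definition sqnormc a : R := complex.Re a ^+ 2 + complex.Im a ^+ 2.

Lemma sqnormc_ge0 a : 0 <= sqnormc a.
Proof. by rewrite addr_ge0 ?sqr_ge0. Qed.

Lemma mulcJ a : a * a^* = (sqnormc a)%:C.
Proof. by case: a => x y; rewrite /sqnormc; simpc; congr (_ +i* _); ring. Qed.

Lemma sqnormcJ a : sqnormc a^*%R = sqnormc a.
Proof. by case: a => x y; rewrite /sqnormc /= sqrrN. Qed.

Section basics.
Context {H : hilbertType R}.
Implicit Types x y z : H.

Lemma innerDl x y z : inner (x + y) z = inner x z + inner y z.
Proof. exact: linearDl. Qed.

Lemma innerDr x y z : inner x (y + z) = inner x y + inner x z.
Proof. exact: linearDr. Qed.

Lemma innerNl x z : inner (- x) z = - inner x z.
Proof. exact: linearNl. Qed.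

Lemma innerNr x z : inner x (- z) = - inner x z.
Proof. exact: linearNr. Qed.

Lemma innerBl x y z : inner (x - y) z = inner x z - inner y z.
Proof. exact: linearBl. Qed.

Lemma innerBr x y z : inner x (y - z) = inner x y - inner x z.
Proof. exact: linearBr. Qed.

Lemma inner0l z : inner (0 : H) z = 0.
Proof. exact: linear0l. Qed.

Lemma inner0r x : inner x (0 : H) = 0.
Proof. exact: linear0r. Qed.

Lemma innerZl a x y : inner (a *: x) y = a * inner x y.
Proof. exact: linearZl_LR. Qed.

Lemma innerZr a x y : inner x (a *: y) = a^* * inner x y.
Proof. exact: linearZr_LR. Qed.

Lemma innerC x y : inner x y = (inner y x)^*%R.
Proof. by rewrite (hermC (inner : {dot H for Num.conj}) x y) expr0 mul1r. Qed.

Lemma inner_suml {I : Type} (s : seq I) (P : pred I) (f : I -> H) z :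
  inner (\sum_(i <- s | P i) f i) z = \sum_(i <- s | P i) inner (f i) z.
Proof. exact: linear_sumlz. Qed.

Lemma inner_sumr {I : Type} (s : seq I) (P : pred I) (f : I -> H) z :
  inner z (\sum_(i <- s | P i) f i) = \sum_(i <- s | P i) inner z (f i).
Proof. exact: linear_sumr. Qed.

Lemma rnormE x : `|x| = (rnorm x)%:C.
Proof.
by have /eqP := ger0_Im (normr_ge0 x); rewrite /rnorm; case: `|x| => ? ? /= /eqP ->.
Qed.

Lemma rnorm_ge0 x : 0 <= rnorm x.
Proof. by rewrite -ler0c -rnormE. Qed.

Lemma rnorm_eq0 x : rnorm x = 0 -> x = 0.
Proof. by move=> x0; apply: normr0_eq0; rewrite rnormE x0. Qed.

Lemma inner_rnorm x : inner x x = (rnorm x ^+ 2)%:C.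
Proof. by rewrite inner_norm rnormE rmorphXn. Qed.

Lemma sqrnormE x : complex.Re (`|x| ^+ 2) = rnorm x ^+ 2.
Proof. by rewrite -inner_norm inner_rnorm. Qed.

Lemma rinner_rnorm x : rinner x x = rnorm x ^+ 2.
Proof. by rewrite /rinner inner_rnorm. Qed.

Lemma rnorm_gt0 x : x <> 0 -> 0 < rnorm x.
Proof.
by move=> x0; rewrite lt_neqAle rnorm_ge0 andbT eq_sym; apply/eqP => /rnorm_eq0.
Qed.

Lemma rinnerC x y : rinner x y = rinner y x.
Proof. by rewrite /rinner innerC; case: (inner y x). Qed.

Lemma rinnerDl x y z : rinner (x + y) z = rinner x z + rinner y z.
Proof. by rewrite /rinner innerDl raddfD. Qed.

Lemma rinnerDr x y z : rinner x (y + z) = rinner x y + rinner x z.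
Proof. by rewrite /rinner innerDr raddfD. Qed.

Lemma rinnerNl x z : rinner (- x) z = - rinner x z.
Proof. by rewrite /rinner innerNl raddfN. Qed.

Lemma rinnerNr x z : rinner x (- z) = - rinner x z.
Proof. by rewrite /rinner innerNr raddfN. Qed.

Lemma rinnerZl (t : R) x y : rinner (t%:C *: x) y = t * rinner x y.
Proof. by rewrite /rinner innerZl; case: (inner x y) => ? ? /=; ring. Qed.

Lemma rinnerZr (t : R) x y : rinner x (t%:C *: y) = t * rinner x y.
Proof. by rewrite rinnerC rinnerZl rinnerC. Qed.

Definition rinnerE := (rinnerDl, rinnerDr, rinnerNl, rinnerNr, rinnerZl, rinnerZr).

Lemma sqrnormD x y :
  rnorm (x + y) ^+ 2 = rnorm x ^+ 2 + 2 * rinner x y + rnorm y ^+ 2.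
Proof. by rewrite -!rinner_rnorm !rinnerE (rinnerC y x); ring. Qed.

Lemma sqrnormB x y :
  rnorm (x - y) ^+ 2 = rnorm x ^+ 2 - 2 * rinner x y + rnorm y ^+ 2.
Proof. by rewrite -!rinner_rnorm !rinnerE (rinnerC y x); ring. Qed.

Lemma rnormD x y : rnorm (x + y) <= rnorm x + rnorm y.
Proof. by rewrite -lecR rmorphD /= -!rnormE ler_normD. Qed.

Lemma rnormN x : rnorm (- x) = rnorm x.
Proof. by rewrite /rnorm normrN. Qed.

Lemma rnormBC x y : rnorm (x - y) = rnorm (y - x).
Proof. by rewrite -opprB rnormN. Qed.

Lemma rnorm_dist_triangle z x y : rnorm (x - y) <= rnorm (x - z) + rnorm (z - y).
Proof. by rewrite -(subrKA z) rnormD. Qed.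

Lemma rnorm0 : rnorm (0 : H) = 0.
Proof. by rewrite /rnorm normr0. Qed.

Lemma sqrnormZ a x : rnorm (a *: x) ^+ 2 = sqnormc a * rnorm x ^+ 2.
Proof.
apply: (@complexI R); rewrite -inner_rnorm innerZl innerZr mulrA mulcJ.
by rewrite inner_rnorm -rmorphM.
Qed.

Lemma rnormZ (t : R) x : rnorm (t%:C *: x) = `|t| * rnorm x.
Proof.
apply: (@complexI R); rewrite -rnormE normrZ rmorphM /= -rnormE; congr (_ * _).
by rewrite normc_def /= expr0n addr0 sqrtr_sqr.
Qed.

(** Cauchy-Schwarz, from [0 <= | |y| x - |x| y |^2 = 2 |x| |y| (|x| |y| - Re <x, y>)]. *)
Lemma rinner_le x y : rinner x y <= rnorm x * rnorm y.
Proof.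
have [/rnorm_eq0 ->|x0] := eqVneq (rnorm x) 0.
  by rewrite rnorm0 mul0r /rinner inner0l.
have [/rnorm_eq0 ->|y0] := eqVneq (rnorm y) 0.
  by rewrite rnorm0 mulr0 /rinner inner0r.
have xy_gt0 : 0 < rnorm x * rnorm y.
  by rewrite mulr_gt0// lt_neqAle eq_sym rnorm_ge0 ?x0 ?y0.
have := sqr_ge0 (rnorm ((rnorm y)%:C *: x - (rnorm x)%:C *: y)).
rewrite sqrnormB !rnormZ !rinnerE !ger0_norm ?rnorm_ge0//.
move: (rinner x y) (rnorm x) (rnorm y) xy_gt0 => p u v uv_gt0 h.
rewrite -subr_ge0 -(pmulr_rge0 _ uv_gt0); move: h.
by rewrite (_ : _ + _ = 2 * (u * v * (u * v - p))) ?pmulr_rge0//; ring.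
Qed.

Lemma normr_rinner_le x y : `|rinner x y| <= rnorm x * rnorm y.
Proof.
by rewrite ler_norml rinner_le lerNl -rinnerNl -(rnormN x) rinner_le.
Qed.

Lemma rinner_i x y : rinner x ('i *: y) = complex.Im (inner x y).
Proof. by rewrite /rinner innerZr; case: (inner x y) => ? ? /=; ring. Qed.

Lemma inner_eq0 x y : rinner x y = 0 -> rinner x ('i *: y) = 0 -> inner x y = 0.
Proof. by rewrite rinner_i /rinner; case: (inner x y) => ? ? /= -> ->. Qed.

Lemma rnorm_i x : rnorm ('i *: x) = rnorm x.
Proof.
apply/eqP; rewrite -(@eqrXn2 _ 2) ?rnorm_ge0// sqrnormZ.
by rewrite /sqnormc /= expr0n expr1n add0r mul1r.
Qed.

End basics.
End real_norm.

(** * Completeness and orthogonal decomposition *)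

Section completeness.
Context {R : realType} {H : hilbertType R}.
Implicit Types (x y z : H) (u : nat -> H).

Definition rcvg u z := forall e : R, 0 < e ->
  exists N, forall n, (N <= n)%N -> rnorm (z - u n) < e.

Definition rcauchy u := forall e : R, 0 < e ->
  exists N, forall m n, (N <= m)%N -> (N <= n)%N -> rnorm (u m - u n) < e.

Lemma complex_gt0E (e : R[i]) : 0 < e -> e = (complex.Re e)%:C /\ 0 < complex.Re e.
Proof. by case: e => a b; rewrite ltcE /= => /andP[/eqP -> ?]. Qed.

Lemma hilbert_complete u : rcauchy u -> exists z, rcvg u z.
Proof.
move=> uC; have u_cvg : cvg (u @ \oo).
  apply: cauchy_cvg; apply: cauchy_exP => e /complex_gt0E [-> e0].
  have [N uN] := uC _ e0; exists (u N); exists N => // n /= Nn.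
  by rewrite -ball_normE /= rnormE ltcR uN.
exists (lim (u @ \oo)) => e e0.
move/cvgrPdist_lt: u_cvg => /(_ e%:C); rewrite ltcR => /(_ e0) [N _ uN].
by exists N => n /uN /=; rewrite rnormE ltcR.
Qed.

(* The distance from [y] to [V] is attained in the closure of [V]: the
   parallelogram identity makes minimizing sequences Cauchy. *)
Lemma orthogonal_decomposition (V : set H) y :
    V 0 -> (forall a x z, V x -> V z -> V (a *: x + z)) ->
  exists z, (forall e : R, 0 < e -> exists2 v, V v & rnorm (z - v) < e) /\
    (forall v, V v -> inner (y - z) v = 0).
Proof.
move=> V0 Vlin; pose D := [set rnorm (y - v) ^+ 2 | v in V].
have D0 : D !=set0 by exists (rnorm (y - 0) ^+ 2), 0.
have Dlb : lbound D 0 by move=> _ [v _ <-]; rewrite sqr_ge0.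
have hD : has_inf D by split => //; exists 0.
pose d := inf D.
have dle v : V v -> d <= rnorm (y - v) ^+ 2.
  by move=> Vv; apply: ge_inf; [exists 0|exists v].
have /choice [u uP] (n : nat) : exists v, V v /\ rnorm (y - v) ^+ 2 < d + n.+1%:R^-1.
  have [] := @inf_adherent _ D n.+1%:R^-1 _ hD; first by rewrite invr_gt0.
  by move=> _ [v Vv <-] lt_v; exists v.
have VD v w : V v -> V w -> V (v + w).
  by move=> Vv Vw; rewrite -[v]scale1r; apply: Vlin.
have VZ a v : V v -> V (a *: v).
  by move=> Vv; rewrite -[_ *: _]addr0; apply: Vlin.
have inv_lt (e : R) : 0 < e ->
    exists N, forall n, (N <= n)%N -> (n.+1%:R^-1 : R) < e.
  by move=> e0; have [N _ Ne] := near_infty_natSinv_lt (PosNum e0); exists N.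
have uC : rcauchy u.
  move=> e e0; have e4 : 0 < e ^+ 2 / 4 by rewrite divr_gt0 ?exprn_gt0.
  have [N Ne] := inv_lt _ e4.
  exists N => m n Nm Nn; rewrite -(@ltr_pXn2r _ 2) ?nnegrE ?rnorm_ge0 ?ltW//.
  have [Vm lem] := uP m; have [Vn len] := uP n.
  have := dle _ (VZ (2^-1 : R)%:C _ (VD _ _ Vm Vn)).
  rewrite (_ : u m - u n = (y - u n) - (y - u m)); last first.
    by rewrite opprB [RHS]addrC subrKA.
  rewrite (_ : y - _ = 2^-1%:C *: ((y - u m) + (y - u n))); last first.
    rewrite addrACA -opprD scalerBr; congr (_ - _).
    rewrite -[X in X + X]scale1r -scalerDl scalerA -(rmorphD _ 1 1) -rmorphM /=.
    by rewrite mulVf ?scale1r.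
  rewrite rnormZ (sqrnormB (y - u n)) exprMn (sqrnormD (y - u m)) rinnerC.
  rewrite ger0_norm ?invr_ge0//.
  move: lem len (Ne _ Nm) (Ne _ Nn).
  move: (rnorm (y - u m) ^+ 2) (rnorm (y - u n) ^+ 2) (rinner _ _) => p q r.
  move: (m.+1%:R^-1) (n.+1%:R^-1) (e ^+ 2) => *; lra.
have [z uz] := hilbert_complete uC.
exists z; split.
  move=> e e0; have [N zN] := uz e e0.
  by exists (u N); [have [] := uP N|exact: zN].
suff rV v : V v -> rinner (y - z) v = 0.
  by move=> v Vv; apply: inner_eq0; apply: rV => //; apply: VZ.
(* Moving [u n] by [(r / c) v] stays in [V], so the squared distance does not drop below [d]; as
   that of [u n] is nearly [d], this forces [r^2 <= e M] for every [e > 0]. The [+ 1] keeps [c]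
   nonzero when [v = 0]. *)
move=> Vv; set r := rinner (y - z) v; pose c := rnorm v ^+ 2 + 1.
have c0 : 0 < c by rewrite ltr_wpDl ?sqr_ge0.
have cn0 := lt0r_neq0 c0.
pose M := c + 2 * `|r| * rnorm v.
have M0 : 0 < M by rewrite ltr_pwDl// ?mulr_ge0 ?rnorm_ge0.
have r2le (e : R) : 0 < e -> r ^+ 2 <= e * M.
  move=> e0; have [N1 zN] := uz e e0; have [N2 Ne] := inv_lt _ e0.
  pose n := maxn N1 N2; have [Vn un] := uP n.
  have un' : n.+1%:R^-1 < e by apply: Ne; rewrite leq_maxr.
  have zn : rnorm (z - u n) < e by apply: zN; rewrite leq_maxl.
  have rE : rinner (y - u n) v = r + rinner (z - u n) v.
    by rewrite -rinnerDl subrKA.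
  have := dle _ (VD _ _ Vn (VZ (r / c)%:C _ Vv)).
  rewrite opprD addrA (sqrnormB (y - u n)) rnormZ rinnerZr rE exprMn.
  rewrite real_normK ?num_real// exprMn exprVn => dle_n.
  have := normr_rinner_le (z - u n) v; rewrite ler_norml => /andP[lo hi].
  have vn := rnorm_ge0 v.
  have rr : - (r * rinner (z - u n) v) <= `|r| * (e * rnorm v).
    rewrite -mulrN (le_trans (ler_norm _))// normrM normrN ler_wpM2l//.
    by rewrite ler_norml; apply/andP; split; nra.
  have vc : r ^+ 2 / c ^+ 2 * rnorm v ^+ 2 <= r ^+ 2 / c.
    rewrite -mulrA ler_wpM2l ?sqr_ge0// ler_pdivrMl ?exprn_gt0//.
    by rewrite (expr2 c) mulfK// /c lerDl.
  have : 2 * (r / c * (r + rinner (z - u n) v)) <= e + r ^+ 2 / c.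
    move: dle_n un un' vc.
    move: (r / c * _) (_ * rnorm v ^+ 2) (r ^+ 2 / c) (rnorm (y - _) ^+ 2) (n.+1%:R^-1) => *.
    lra.
  rewrite -(ler_pM2r c0) [leRHS]mulrDl divfK//.
  rewrite (_ : 2 * _ * c = 2 * (r * (r + rinner (z - u n) v)) * (c / c)); last by ring.
  by rewrite divff// mulr1 /M; nra.
apply/eqP; rewrite -sqrf_eq0 eq_le sqr_ge0 andbT; apply/ler_addgt0Pl => e e0.
by rewrite addr0 -[leRHS](divfK (lt0r_neq0 M0)) r2le// divr_gt0.
Qed.
End completeness.

(** * Riesz representation and adjoints *)

Section operators.
Context {R : realType}.
Implicit Types H G F : hilbertType R.

Section linear.
Context {H G : hilbertType R} {T : H -> G} (linT : linear T).

Lemma opD x y : T (x + y) = T x + T y.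
Proof. by have := linT 1 x y; rewrite !scale1r. Qed.

Lemma op0 : T 0 = 0.
Proof. by apply: (addIr (T 0)); rewrite -opD !add0r. Qed.

Lemma opZ a x : T (a *: x) = a *: T x.
Proof. by have := linT a x 0; rewrite op0 !addr0. Qed.

Lemma opN x : T (- x) = - T x.
Proof. by rewrite -scaleN1r opZ scaleN1r. Qed.

Lemma opB x y : T (x - y) = T x - T y.
Proof. by rewrite opD opN. Qed.

Lemma op_sum {I : Type} (s : seq I) (P : pred I) (f : I -> H) :
  T (\sum_(i <- s | P i) f i) = \sum_(i <- s | P i) T (f i).
Proof. exact: (big_morph T opD op0). Qed.

End linear.

Lemma bounded_opP H G (T : H -> G) : bounded_op T <->
  linear T /\ exists M : R, forall x, rnorm (T x) <= M * rnorm x.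
Proof.
split=> -[linT]; last first.
  move=> [M TM]; split=> //.
  pose TL : {linear H -> G} := HB.pack T (GRing.isLinear.Build _ _ _ _ T linT).
  rewrite -[T]/(TL : H -> G); apply: bounded_linear_continuous.
  apply/linear_boundedP; near=> r => x; rewrite !rnormE.
  have rM : M%:C <= r by near: r; apply: nbhs_pinfty_ge; rewrite complex_real.
  apply: le_trans (ler_wpM2r _ rM); last by rewrite ler0c rnorm_ge0.
  by rewrite -rmorphM lecR.
move=> cT; split=> //.
pose TL : {linear H -> G} := HB.pack T (GRing.isLinear.Build _ _ _ _ T linT).
have /linear_boundedP[M [Mreal hM]] : bounded_near TL (nbhs (0 : H)).
  exact: (@continuous_linear_bounded _ _ _ 0 TL (cT 0)).
have /complex_realP[m Mm] := Mreal.
(* [hM] applies to constants strictly above [M], hence the [+ 1]. *)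
exists (m + 1) => x; rewrite -lecR rmorphM /= -!rnormE.
by apply: hM; rewrite Mm ltcR ltrDl.
Unshelve. all: by end_near. Qed.

Lemma contraction_bounded H G (T : H -> G) : contraction_op T -> bounded_op T.
Proof.
move=> [linT T1]; apply/bounded_opP; split=> //; exists 1 => x.
by rewrite mul1r -lecR -!rnormE.
Qed.

Lemma bounded_op_comp H G F (T : H -> G) (U : G -> F) :
  bounded_op T -> bounded_op U -> bounded_op (U \o T).
Proof.
move=> [linT cT] [linU cU]; split=> [a x y|]; first by rewrite /= linT linU.
by move=> x; apply: continuous_comp; [exact: cT|exact: cU].
Qed.

Lemma innerI H (x y : H) : (forall z, inner z x = inner z y) -> x = y.
Proof.
move=> xy; apply/subr0_eq/rnorm_eq0/eqP; rewrite -sqrf_eq0 -rinner_rnorm.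
by rewrite /rinner innerBr xy subrr.
Qed.

(** The representing vector is a multiple of [w = y - z], the component orthogonal to [ker f] of
    some [y] with [f y <> 0]. Since [z] is only a limit of kernel vectors, the bound on [f] is what
    gives [f z = 0]; it controls real parts, and ['i *: z] supplies the imaginary one. *)
Lemma riesz H (f : H -> R[i]) (M : R) : scalar f ->
    (forall x, `|complex.Re (f x)| <= M * rnorm x) ->
  exists z, forall x, f x = inner x z.
Proof.
move=> linf fM.
have f0 : f 0 = 0 by apply: (addIr (f 0)); have := linf 1 0 0; rewrite scale1r mul1r !add0r.
have [f_eq0|/existsNP[y fy]] := pselect (forall x, f x = 0).
  by exists 0 => x; rewrite inner0r f_eq0.
have fD x x' : f (x + x') = f x + f x' by have := linf 1 x x'; rewrite scale1r mul1r.
have fZ a x : f (a *: x) = a * f x by have := linf a x 0; rewrite f0 !addr0.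
have [z [zlim zP]] := @orthogonal_decomposition _ _ [set x | f x = 0] y f0
  (fun a x x' (fx : f x = 0) (fx' : f x' = 0) =>
     etrans (linf a x x') ltac:(by rewrite fx fx' mulr0 addr0)).
have Re0 t : (forall e : R, 0 < e -> exists2 v, f v = 0 & rnorm (t - v) < e) ->
    complex.Re (f t) = 0.
  move=> tlim; apply/eqP; rewrite -normr_eq0 eq_le normr_ge0 andbT.
  apply/ler_addgt0Pl => e e0; rewrite addr0.
  have M1 : 0 < `|M| + 1 by rewrite ltr_wpDl.
  have [v fv tv] := tlim (e / (`|M| + 1)) (divr_gt0 e0 M1).
  have -> : f t = f (t - v) by rewrite fD -scaleN1r fZ fv mulr0 addr0.
  apply: le_trans (fM _) _; rewrite -[leRHS](divfK (lt0r_neq0 M1)) mulrC.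
  apply: le_trans (_ : rnorm (t - v) * (`|M| + 1) <= _).
    by rewrite ler_wpM2l ?rnorm_ge0// (le_trans (ler_norm _))// lerDl.
  by rewrite ler_wpM2r ?ltW.
have fz : f z = 0.
  have := Re0 _ zlim; have := Re0 ('i *: z).
  rewrite fZ; case: (f z) => a b /= h1 ->; congr (_ +i* _).
  apply: oppr_inj; rewrite oppr0 -[RHS]h1; first by ring.
  move=> e /zlim[v fv zv]; exists ('i *: v); first by rewrite fZ fv mulr0.
  by rewrite -scalerBr rnorm_i.
pose w := y - z; have fw : f w <> 0 by rewrite /w fD -scaleN1r fZ fz mulr0 addr0.
have w0 : w <> 0 by move=> w0; apply: fw; rewrite w0.
have ww : inner w w != 0.
  rewrite inner_rnorm; apply/eqP => /complexI/eqP; rewrite sqrf_eq0 => /eqP.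
  by move/rnorm_eq0.
exists ((f w / inner w w)^* *: w) => x; rewrite innerZr conjCK.
have : inner w (x - (f x / f w) *: w) = 0.
  apply: zP => /=; rewrite fD -scaleNr fZ mulNr divfK ?subrr//.
  exact/eqP.
rewrite innerC => /(congr1 Num.conj); rewrite conjCK conjC0.
rewrite innerBl innerZl => /subr0_eq ->; have /eqP := fw => fw'.
by field; rewrite ww fw'.
Qed.

Lemma adjointP H G (T : H -> G) : bounded_op T ->
  forall x y, inner (T x) y = inner x (adjoint T y).
Proof.
move=> /bounded_opP[linT [M TM]] x y.
suff : [set z | forall x, inner (T x) y = inner x z] (adjoint T y) by apply.
have [z zP] : exists z, forall x, inner (T x) y = inner x z.
  apply: (@riesz _ (fun x => inner (T x) y) (M * rnorm y)).
    by move=> a u v; rewrite linT innerDl innerZl.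
  move=> u; rewrite -/(rinner _ _) (le_trans (normr_rinner_le _ _))//.
  by rewrite mulrAC ler_wpM2r ?rnorm_ge0.
exact: (@xgetPex _ 0 [set z | forall x, inner (T x) y = inner x z]) (ex_intro _ z zP).
Qed.

Lemma adjoint_linear H G (T : H -> G) : bounded_op T -> linear (adjoint T).
Proof.
move=> bT a x y; apply: innerI => z.
by rewrite -adjointP// !innerDr !innerZr !adjointP.
Qed.

Lemma adjoint_inner H G (T : H -> G) : bounded_op T ->
  forall x y, inner (adjoint T x) y = inner x (T y).
Proof. by move=> bT x y; rewrite innerC -adjointP// -innerC. Qed.

(** With [a = T^* y], [|a|^2 = Re <T a, y> <= |a| |y|]. *)
Lemma adjoint_contraction H G (T : H -> G) :
  contraction_op T -> contraction_op (adjoint T).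
Proof.
move=> cT; have bT := contraction_bounded cT; split; first exact: adjoint_linear.
move=> y; rewrite !rnormE lecR; set a := adjoint T y.
have [->|a0] := pselect (rnorm a = 0); first exact: rnorm_ge0.
have {}a0 : 0 < rnorm a by rewrite lt_neqAle rnorm_ge0 eq_sym andbT; apply/eqP.
rewrite -(ler_pM2l a0) -expr2 -rinner_rnorm /rinner -adjointP// -/(rinner _ _).
rewrite (le_trans (rinner_le _ _))// ler_wpM2r ?rnorm_ge0//.
by rewrite -lecR -!rnormE; case: cT.
Qed.

End operators.

(** * Orthonormal bases and Hilbert-Schmidt norms *)

Lemma exchange_esum (R : realType) (T1 T2 : choiceType) (I : set T1) (J : set T2)
    (a : T1 -> T2 -> \bar R) : (forall i j, I i -> J j -> (0 <= a i j)%E) ->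
  \esum_(i in I) \esum_(j in J) a i j = \esum_(j in J) \esum_(i in I) a i j.
Proof.
move=> a0; rewrite !esum_esum//; last by move=> j i Jj Ii; exact: a0.
apply: (@reindex_esum _ _ _ _ _ (fun p => (p.2, p.1))); split.
- by move=> [j i] [Jj Ii].
- by move=> [j i] [j' i'] _ _ [-> ->].
- by move=> [i j] [Ii Jj]; exists (j, i).
Qed.

Section orthonormal_bases.
Context {R : realType}.
Implicit Types H G : hilbertType R.
Local Notation onb H := (@Defs.onb _ H).

(** Zorn gives a maximal orthonormal set; a nonzero vector orthogonal to it could be normalized and
    added. *)
Lemma onb_basis H : orthonormal_basis (onb H).
Proof.
suff [B onB] : exists B : set H, orthonormal_basis B by exact: (xgetPex set0 (ex_intro _ B onB)).
have [|B [[B1 Borth] Bmax]] := @Zorn_bigcup H (@orthonormal_set R H).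
  move=> F FP Ftot; split=> [x [X FX Xx]|x y [X FX Xx] [Y FY Yy]].
    by have [+ _] := FP _ FX; apply.
  have [XY|YX] := Ftot _ _ FX FY.
    by have [_] := FP _ FY; apply => //; apply: XY.
  by have [_] := FP _ FX; apply => //; apply: YX.
exists B; split=> // x xB; apply: contrapT => x0.
have xgt0 := rnorm_gt0 x0; pose y := (rnorm x)^-1%:C *: x.
have yB b : B b -> inner y b = 0 by move=> Bb; rewrite innerZl xB ?mulr0.
have By b : B b -> inner b y = 0 by move=> Bb; rewrite innerC yB ?conjC0.
have yy : inner y y = 1.
  rewrite inner_rnorm rnormZ ger0_norm ?invr_ge0 ?rnorm_ge0//.
  by rewrite mulVf ?lt0r_neq0// expr1n.
apply: (Bmax (B `|` [set y])).
  split=> [|yB']; first by left.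
  have By' : B y by apply: yB'; right.
  by have /eqP := B1 _ By'; rewrite yB// eq_sym oner_eq0.
split=> [z [/B1//|->//]|z t [Bz|->] [Bt|->]//]; [exact: Borth|by rewrite By|].
by rewrite yB.
Qed.

Section bessel.
Context {H : hilbertType R} {I : eqType} (f : I -> H) (s : seq I).
Hypotheses (us : uniq s)
  (fs : {in s &, forall i j, inner (f i) (f j) = (i == j)%:R}).
Implicit Type x : H.

Lemma inner_proj x i : i \in s ->
  inner (\sum_(j <- s) inner x (f j) *: f j) (f i) = inner x (f i).
Proof.
move=> si; rewrite inner_suml (bigD1_seq i)//= innerZl fs// eqxx mulr1.
rewrite big_seq_cond big1 ?addr0// => j /andP[sj ji].
by rewrite innerZl fs// (negbTE ji) mulr0.
Qed.

(** The index list [s] lets one statement serve both an indexed orthonormal family and, with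
    [f = id], a finite list of basis vectors. *)
Lemma bessel_eq x : rnorm (x - \sum_(i <- s) inner x (f i) *: f i) ^+ 2 =
  rnorm x ^+ 2 - \sum_(i <- s) sqnormc (inner x (f i)).
Proof.
set p := \sum_(i <- s) _.
have xpE (y : H) : {in s, forall i, inner y (f i) = inner x (f i)} ->
    inner y p = (\sum_(i <- s) sqnormc (inner x (f i)))%:C.
  move=> yx; rewrite inner_sumr rmorph_sum [LHS]big_seq [RHS]big_seq.
  by apply: eq_bigr => i si; rewrite innerZr yx// mulrC mulcJ.
have pp := xpE p (inner_proj x).
rewrite sqrnormB -(rinner_rnorm p) /rinner pp xpE//=; ring.
Qed.

Lemma bessel x : \sum_(i <- s) sqnormc (inner x (f i)) <= rnorm x ^+ 2.
Proof. by rewrite -subr_ge0 -bessel_eq sqr_ge0. Qed.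

(** Pythagoras: [x - p] is orthogonal to every [f i], hence to [p - q]. *)
Lemma best_approximation x (c : I -> R[i]) :
  rnorm (x - \sum_(i <- s) inner x (f i) *: f i) <=
  rnorm (x - \sum_(i <- s) c i *: f i).
Proof.
set p := \sum_(i <- s) _; set q := \sum_(i <- s) _.
rewrite -(@ler_pXn2r _ 2) ?nnegrE ?rnorm_ge0// -(subrKA p x (- q)).
suff xp : rinner (x - p) (p - q) = 0.
  by rewrite [leRHS]sqrnormD xp mulr0 addr0 lerDl sqr_ge0.
rewrite -sumrB /rinner inner_sumr big_seq big1// => i si.
by rewrite -scalerBl innerZr innerBl inner_proj// subrr mulr0.
Qed.

End bessel.

(** Bessel on finite subsets gives one inequality. For the other, a basis is only known to have no
    nonzero orthogonal vector; decomposing [x] along the span [V] then makes [x] a limit of finite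
    combinations, and the orthogonal projection on the same basis vectors is at least as close. *)
Lemma parseval H (x : H) :
  \esum_(b in onb H) (sqnormc (inner x b))%:E = (rnorm x ^+ 2)%:E.
Proof.
have [[B1 Borth] Bmax] := onb_basis H.
have onB (t : seq H) : {in t, forall b, onb H b} ->
    {in t &, forall a b : H, inner a b = (a == b)%:R}.
  move=> tB a b /tB Ba /tB Bb; have [->|/eqP ab] := eqVneq; first exact: B1.
  exact: Borth.
apply/eqP; rewrite eq_le; apply/andP; split.
  rewrite ge_ereal_sup//= => _ [X [finX XB] <-].
  rewrite fsbig_finite//= sumEFin lee_fin; apply: (bessel (f := id)).
    exact: finmap.fset_uniq.
  apply: onB => b; rewrite in_fset_set// => /set_mem; exact: XB.
pose V := [set v : H | exists2 s : seq (R[i] * H),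
  {in s, forall p, onb H p.2} & v = \sum_(p <- s) p.1 *: p.2].
have V0 : V 0 by exists [::]; rewrite ?big_nil.
have Vlin a y z : V y -> V z -> V (a *: y + z).
  move=> [s sB ->] [t tB ->].
  exists ([seq (a * p.1, p.2) | p <- s] ++ t).
    by move=> p; rewrite mem_cat => /orP[/mapP[q /sB ? ->]|/tB].
  rewrite big_cat big_map scaler_sumr; congr (_ + _).
  by apply: eq_bigr => p _; rewrite scalerA.
have [z [zlim zorth]] := orthogonal_decomposition x V0 Vlin.
have zx : x = z.
  apply/subr0_eq/Bmax => b Bb; apply: zorth; exists [:: (1, b)].
    by move=> p; rewrite inE => /eqP ->.
  by rewrite big_seq1 scale1r.
apply/lee_addgt0Pr => e e0.
have [v [s sB vE] xv] := zlim (Num.sqrt e) ltac:(by rewrite sqrtr_gt0).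
(* A combination in [V] may repeat a basis vector; its coefficients are collected over the
   duplicate-free list [t], as Bessel requires. *)
pose t := undup (map snd s).
have tB : {in t, forall b, onb H b}.
  by move=> b; rewrite mem_undup => /mapP[p /sB ? ->].
have vt : v = \sum_(b <- t) (\sum_(p <- s | p.2 == b) p.1) *: b.
  rewrite vE; under [RHS]eq_bigr do rewrite scaler_suml.
  rewrite (exchange_big_dep xpredT)//= big_seq [RHS]big_seq; apply: eq_bigr => p sp.
  have tp : p.2 \in t by rewrite mem_undup map_f.
  rewrite big_mkcond (bigD1_seq p.2)//= ?undup_uniq// eqxx big1 ?addr0// => b bp.
  by rewrite eq_sym (negbTE bp).
have := best_approximation (f := id) (undup_uniq _) (onB _ tB) x
  (fun b => \sum_(p <- s | p.2 == b) p.1).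
rewrite /= -vt => xt.
have : rnorm x ^+ 2 <= \sum_(b <- t) sqnormc (inner x b) + e.
  rewrite -lerBlDl -(bessel_eq (f := id) (undup_uniq _) (onB _ tB)).
  rewrite -(sqr_sqrtr (ltW e0)) ler_pXn2r ?nnegrE ?rnorm_ge0 ?sqrtr_ge0//.
  by rewrite (le_trans xt)// zx ltW.
rewrite -lee_fin EFinD => /le_trans; apply; rewrite leeD2r// esum_ge//.
exists [set` t]; first by split; [exact: finite_seq|move=> b /tB].
by rewrite -sumEFin fsbig_seq ?undup_uniq.
Qed.

(** The [u i] need not lie in [onb H], so the comparison passes through the adjoint. Parseval in [G]
    turns the left side into a sum over [g] of [sum_i |<u_i, T^* g>|^2], which Bessel bounds by
    [|T^* g|^2]; expanding this in [onb H] and exchanging the sums gives [sum_b |T b|^2]. *)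
Lemma sum_sqnorm_le_hs H G (T : H -> G) m (u : 'I_m -> H) : bounded_op T ->
    (forall i j, inner (u i) (u j) = (i == j)%:R) ->
  ((\sum_i rnorm (T (u i)) ^+ 2)%:E <= hs_normsq T)%E.
Proof.
move=> bT onu; rewrite -sumEFin; under eq_bigr do rewrite -parseval.
have sq0 a : (0 <= (sqnormc a : R)%:E)%E by rewrite lee_fin sqnormc_ge0.
rewrite -esum_sum//; apply: (@le_trans _ _
  (\esum_(g in onb G) \esum_(b in onb H) (sqnormc (inner (adjoint T g) b))%:E)%E).
  apply: le_esum => g _; rewrite sumEFin parseval lee_fin.
  under eq_bigr do rewrite adjointP// innerC sqnormcJ.
  by apply: bessel => //; exact: index_enum_uniq.
rewrite exchange_esum// le_esum// => b _; rewrite sqrnormE -parseval le_esum//.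
by move=> g _; rewrite adjoint_inner// innerC sqnormcJ.
Qed.

End orthonormal_bases.

(** * Square roots *)

Section square_root.
Context {R : realType} {H : hilbertType R}.
Implicit Types (x y z : H) (u v : nat -> H).

Lemma rcvg_unique u y z : rcvg u y -> rcvg u z -> y = z.
Proof.
move=> uy uz; apply/subr0_eq/rnorm_eq0/eqP; rewrite eq_le rnorm_ge0 andbT.
apply/ler_addgt0Pl => e e0; rewrite addr0; have e2 : 0 < e / 2 by rewrite divr_gt0.
have [N yN] := uy _ e2; have [M zM] := uz _ e2.
have := yN (maxn N M) (leq_maxl _ _); have := zM (maxn N M) (leq_maxr _ _).
by have := rnorm_dist_triangle (u (maxn N M)) y z; rewrite (rnormBC (u _) z); lra.
Qed.

Lemma rcvg_le u y (M : R) : rcvg u y ->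
  (forall n, rnorm (u n) <= M) -> rnorm y <= M.
Proof.
move=> uy uM; apply/ler_addgt0Pl => e e0; have [N yN] := uy _ e0.
have := rnormD (y - u N) (u N); rewrite subrK.
by have := yN _ (leqnn N); have := uM N; lra.
Qed.

Lemma rcvg_sum_le u y (M : R) (v w : nat -> H) p q : rcvg v p -> rcvg w q ->
    (forall n, rnorm (y - u n) <= M * rnorm (p - v n) + rnorm (q - w n)) ->
  rcvg u y.
Proof.
move=> vp wq uvw e e0; have M0 : 0 < `|M| + 1 by rewrite ltr_wpDl.
have [N pN] := vp (e / 2 / (`|M| + 1)) ltac:(by rewrite !divr_gt0).
have [N' qN] := wq (e / 2) ltac:(by rewrite divr_gt0).
exists (maxn N N') => n; rewrite geq_max => /andP[/pN + /qN].
rewrite ltr_pdivlMr// => pn qn; apply: le_lt_trans (uvw n) _.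
have := rnorm_ge0 (p - v n); have := ler_norm M; nra.
Qed.

Variable C : H -> H.
Hypotheses (cC : contraction_op C) (symC : forall x y, inner (C x) y = inner x (C y)).

Let linC : linear C. Proof. by case: cC. Qed.

Let half : R[i] := (2^-1)%:C.

(* Solves [X = (C + X^2) / 2], so that [(1 - X)^2 = 1 - C]. *)
Fixpoint sqrt_iter n x : H :=
  if n is m.+1 then half *: (C x + sqrt_iter m (sqrt_iter m x)) else 0.

(* The same iteration for scalars, with [C = 1]; it majorizes [sqrt_iter]. *)
Fixpoint sqrt_bound n : R :=
  if n is m.+1 then 2^-1 * (1 + sqrt_bound m ^+ 2) else 0.

Let B := sqrt_iter.
Let b := sqrt_bound.

Let halfD x : half *: x + half *: x = x.
Proof.
rewrite -scalerDl /half -(rmorphD _ (2^-1) (2^-1)).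
by rewrite (_ : 2^-1 + 2^-1 = 1 :> R) ?scale1r//; field.
Qed.

Let rnorm_half x : rnorm (half *: x) = 2^-1 * rnorm x.
Proof. by rewrite rnormZ ger0_norm ?invr_ge0. Qed.

Let b01 n : 0 <= b n <= 1.
Proof.
elim: n => [|n /andP[b0 b1]]; rewrite /b /= ?lexx ?ler01// -/b.
apply/andP; split; nra.
Qed.

Let b_mono n m : (n <= m)%N -> b n <= b m.
Proof.
move: n m; apply: (homo_leq (r := fun x y : R => x <= y)) => [x||k].
- exact: lexx.
- by move=> y x z; exact: le_trans.
by rewrite {2}/b /= -/b; have := sqr_ge0 (b k - 1); nra.
Qed.

Let linB n : linear (B n).
Proof.
elim: n => [|n linB] a x y; rewrite /B /= -/B; first by rewrite scaler0 addr0.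
rewrite linC !linB [a *: (half *: _)]scalerA (mulrC a) -scalerA -scalerDr; congr (half *: _).
by rewrite scalerDr addrACA.
Qed.

Let rnormB_le n x : rnorm (B n x) <= b n * rnorm x.
Proof.
elim: n x => [|n IH] x; rewrite /B /b /= -/B -/b; first by rewrite rnorm0 mul0r.
rewrite rnorm_half -mulrA ler_wpM2l ?invr_ge0//.
rewrite (le_trans (rnormD _ _))// mulrDl mul1r lerD//.
  by rewrite -lecR -!rnormE; case: cC.
rewrite (le_trans (IH _))// expr2 -mulrA ler_wpM2l//.
by case/andP: (b01 n).
Qed.

Let commB n (U : H -> H) : linear U -> (forall x, U (C x) = C (U x)) ->
  forall x, U (B n x) = B n (U x).
Proof.
move=> linU UC; elim: n => [|n IH] x; rewrite /B /= -/B; first exact: op0.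
by rewrite opZ// opD// UC !IH.
Qed.

Let commBB n m x : B m (B n x) = B n (B m x).
Proof. by apply: commB => // y; apply/esym/commB. Qed.

Let symB n x y : inner (B n x) y = inner x (B n y).
Proof.
elim: n x y => [|n IH] x y; rewrite /B /= -/B; first by rewrite inner0l inner0r.
rewrite innerZl innerZr innerDl innerDr symC !IH; congr (_ * _).
exact/esym/conjc_real.
Qed.

(** As the iterates commute, a difference of squares factors: [B n.+2 - B n.+1 = (B n.+1 + B n) (B
    n.+1 - B n) / 2]. The scalars [b] satisfy the same identity. *)
Let stepB n x : rnorm (B n.+1 x - B n x) <= (b n.+1 - b n) * rnorm x.
Proof.
elim: n => [|n IH]; first by rewrite !subr0 rnormB_le.
have bS k : b k.+1 = 2^-1 * (1 + b k ^+ 2) by [].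
have BS k y : B k.+1 y = half *: (C y + B k (B k y)) by [].
rewrite (bS n.+1) {2}(bS n) (BS n.+1) {2}(BS n x).
rewrite -scalerBr rnorm_half opprD addrACA subrr add0r.
set d := B n.+1 x - B n x in IH *.
have -> : B n.+1 (B n.+1 x) - B n (B n x) = B n.+1 d + B n d.
  by rewrite /d !(opB (linB _)) (commBB n.+1 n) subrKA.
have := rnormD (B n.+1 d) (B n d); have := rnormB_le n.+1 d; have := rnormB_le n d.
have /andP[bn0 _] := b01 n; have /andP[bSn0 _] := b01 n.+1.
have := ler_wpM2l (addr_ge0 bSn0 bn0) IH; lra.
Qed.

Let distB n m x : (n <= m)%N -> rnorm (B m x - B n x) <= (b m - b n) * rnorm x.
Proof.
elim: m => [|m IH]; first by rewrite leqn0 => /eqP ->; rewrite !subrr rnorm0 mul0r.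
rewrite leq_eqVlt => /orP[/eqP->|]; first by rewrite !subrr rnorm0 mul0r.
rewrite ltnS => /IH {}IH; rewrite (le_trans (rnorm_dist_triangle (B m x) _ _))//.
by rewrite -(subrKA (b m) (b m.+1)) mulrDl; apply: lerD; [exact: stepB|].
Qed.

(** By domination it is enough that [b], increasing and bounded by 1, is Cauchy; [N] is chosen so
    that [b N] is within [e / (|x| + 1)] of the supremum. *)
Let cauchyB x : rcauchy (B ^~ x).
Proof.
move=> e e0; have x1 : 0 < rnorm x + 1 by rewrite ltr_wpDl ?rnorm_ge0.
have supb : has_sup (range b).
  split; first by exists (b 0%N), 0%N.
  by exists 1 => _ [n _ <-]; case/andP: (b01 n).
have [_ [N _ <-] bN] := sup_adherent (divr_gt0 e0 x1) supb.
have bd n m : (N <= n)%N -> (n <= m)%N -> rnorm (B m x - B n x) < e.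
  move=> Nn nm; apply: le_lt_trans (distB x nm) _.
  have bm : b m <= sup (range b) by apply: ub_le_sup; [case: supb|exists m].
  have bmn : b m - b n < e / (rnorm x + 1) by have := b_mono Nn; lra.
  move: bmn; rewrite ltr_pdivlMr// => bmn.
  have := b_mono nm; have := rnorm_ge0 x; nra.
exists N => m n Nm Nn; have [mn|/ltnW nm] := leqP m n; last exact: bd.
by rewrite rnormBC bd.
Qed.

(** [W = 1 - X], where [X] is the pointwise limit of the iterates: [2 X = C + X^2] gives
    [W^2 = 1 - C], while [|X x| <= |x|] and the reality of [<X x, x>] give positivity. *)
Lemma sqrt_id_sub_exists :
  exists W : H -> H, [/\ bounded_op W, positive_op W & W \o W = idfun \- C].
Proof.
have [X XP] := choice (fun x => hilbert_complete (@cauchyB x)).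
have linX : linear X.
  move=> a x y; apply: (rcvg_unique (XP _)).
  apply: (@rcvg_sum_le _ _ (Num.sqrt (sqnormc a)) _ _ _ _ (XP x) (XP y)) => n.
  rewrite linB opprD addrACA -scalerBr (le_trans (rnormD _ _))// lerD2r.
  rewrite -(@ler_pXn2r _ 2) ?nnegrE ?mulr_ge0 ?rnorm_ge0 ?sqrtr_ge0//.
  by rewrite sqrnormZ exprMn sqr_sqrtr ?sqnormc_ge0.
have X1 x : rnorm (X x) <= rnorm x.
  apply: (rcvg_le (XP x)) => // n; rewrite (le_trans (rnormB_le _ _))//.
  by rewrite ler_piMl ?rnorm_ge0//; case/andP: (b01 n).
have XX x : X x = half *: (C x + X (X x)).
  (* The limit passes through the square because [B n] is a contraction: replacing [X x] by [B n x]
     inside [B n] costs at most [|X x - B n x|]. *)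
  have BB : rcvg (fun n => B n (B n x)) (X (X x)).
    apply: (@rcvg_sum_le _ _ 1 _ _ _ _ (XP x) (XP (X x))) => n.
    rewrite (le_trans (rnorm_dist_triangle (B n (X x)) _ _))// addrC lerD2r mul1r.
    rewrite -opB// (le_trans (rnormB_le _ _))//.
    by rewrite ler_piMl ?rnorm_ge0//; case/andP: (b01 n).
  apply: (@rcvg_unique (fun n => B n.+1 x)).
    by move=> e /(XP x)[N xN]; exists N => n /leqW; exact: xN.
  apply: (@rcvg_sum_le _ _ 1 _ _ _ _ BB BB) => n.
  rewrite [B n.+1 x]/B /= -/B -scalerBr opprD addrACA subrr add0r rnorm_half.
  by have := rnorm_ge0 (X (X x) - B n (B n x)); lra.
have rsymX x y : rinner (X x) y = rinner x (X y).
  apply/eqP; rewrite -subr_eq0 -normr_le0; apply/ler_addgt0Pl => e e0.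
  rewrite addr0; pose M := rnorm x + rnorm y + 1.
  have x0 := rnorm_ge0 x; have y0 := rnorm_ge0 y.
  have M0 : 0 < M by rewrite /M; lra.
  have [N xN] := XP x _ (divr_gt0 e0 M0); have [N' yN] := XP y _ (divr_gt0 e0 M0).
  pose n := maxn N N'.
  have := xN n (leq_maxl _ _); have := yN n (leq_maxr _ _).
  rewrite !ltr_pdivlMr// /M.
  have -> : rinner (X x) y - rinner x (X y) =
      rinner (X x - B n x) y - rinner x (X y - B n y).
    rewrite !rinnerE /rinner symB; ring.
  move=> yn xn; apply: le_trans (ler_normB _ _) _.
  have := normr_rinner_le (X x - B n x) y.
  have := normr_rinner_le x (X y - B n y).
  have := rnorm_ge0 (X x - B n x); have := rnorm_ge0 (X y - B n y); nra.
have ImX x : complex.Im (inner (X x) x) = 0.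
  have E : complex.Im (inner (X x) x) = complex.Im (inner x (X x)).
    by rewrite -!rinner_i rsymX opZ.
  by move: E; rewrite [inner x _]innerC; case: (inner _ _) => ? c /=; lra.
exists (idfun \- X); split.
- apply/bounded_opP; split=> [a x y|].
    by rewrite /= linX scalerBr opprD addrACA.
  exists 2 => x /=; rewrite (le_trans (rnormD _ _))// rnormN.
  by have := X1 x; lra.
- move=> x; rewrite /= innerBl lecE raddfB /= ImX inner_rnorm /= subr0 eqxx /=.
  rewrite raddfB /= subr_ge0 (le_trans (rinner_le _ _))// expr2.
  by rewrite ler_wpM2r ?rnorm_ge0.
- apply/funext => x /=.
  have E : X x + X x = C x + X (X x) by rewrite -(halfD (C x + X (X x))) -!XX.
  by rewrite opB// opprB addrA addrAC -(addrA x) -opprD E opprD addrA subrK.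
Qed.

End square_root.

(** * Finite-dimensional linear algebra *)

Section kernel.
Context {R : realType} {H G : hilbertType R} {T : H -> G} {N n : nat} {w : 'I_n -> H}.
Hypotheses (linT : linear T)
  (rankT : forall m (v : 'I_m -> H), lin_free (T \o v) -> (m <= N)%N)
  (w_free : lin_free w).

Let gram : 'M[R[i]]_n := \matrix_(i, j) inner (T (w i)) (T (w j)).

(** A linear relation among the [T (w i)] is also one among the rows of the Gram matrix, so
    independent rows come from independent vectors. This converts the operator rank into a matrix
    rank. *)
Lemma rank_gram : (\rank gram <= N)%N.
Proof.
apply: (rankT (v := w \o maxrankfun gram)) => d d0 k.
suff D0 : \row_j d j = 0 :> 'rV_(\rank gram) by have := congr1 (fun A : 'rV__ => A 0 k) D0; rewrite !mxE.
apply: (row_free_inj (maxrowsub_free gram)); rewrite mul0mx.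
apply/rowP => j; rewrite !mxE.
have := inner0l (T (w j)); rewrite -d0 inner_suml => dj; rewrite -[RHS]dj.
by apply: eq_bigr => i _; rewrite !mxE innerZl.
Qed.

(* A nonzero row in the common kernel of the Gram matrix of [T \o w] and of the
   inner products with [u] gives one more vector, as long as [k + N < n]. *)
Lemma orthonormal_in_kernel k : (k + N <= n)%N -> exists u : 'I_k -> H,
  [/\ forall i j, inner (u i) (u j) = (i == j)%:R,
      forall i, T (u i) = 0
    & forall i, exists c : 'I_n -> R[i], u i = \sum_j c j *: w j].
Proof.
elim: k => [|k IH]; first by exists (fun=> 0); split=> -[].
rewrite addSn => kn; have [u [onu Tu wu]] := IH (ltnW kn).
pose L := \matrix_(i < n, j < k) inner (w i) (u j).
(* The Gram block contributes at most [N] to the rank and [L] at most [k]. *)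
have rkML : (\rank (row_mx gram L) < n)%N.
  apply: leq_ltn_trans kn; rewrite -mxrank_tr tr_row_mx -addsmxE addnC.
  rewrite (leq_trans (mxrank_adds_leqif _ _).1)// !mxrank_tr.
  by rewrite leq_add ?rank_gram ?rank_leq_col.
have /rowV0Pn[c /sub_kermxP] : kermx (row_mx gram L) != 0.
  by rewrite -mxrank_eq0 mxrank_ker subn_eq0 -ltnNge.
rewrite mul_mx_row -[0]row_mx0 => /eq_row_mx[cM cL] c0.
pose x := \sum_j c 0 j *: w j.
have TxE : T x = \sum_j c 0 j *: T (w j).
  by rewrite /x (op_sum linT); apply: eq_bigr => j _; rewrite (opZ linT).
(* The kernel row makes [T x] orthogonal to each [T (w j)], hence to itself. *)
have Tx : T x = 0.
  apply/rnorm_eq0/eqP; rewrite -sqrf_eq0 -rinner_rnorm /rinner {2}TxE.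
  rewrite inner_sumr big1// => j _; rewrite innerZr TxE inner_suml.
  have /rowP/(_ j) := cM; rewrite !mxE => cMj.
  rewrite (_ : \sum_(i < n) _ = 0) ?mulr0//; rewrite -[RHS]cMj.
  by apply: eq_bigr => i _; rewrite innerZl mxE.
have xu j : inner x (u j) = 0.
  have /rowP/(_ j) := cL; rewrite !mxE => cLj.
  rewrite inner_suml -[RHS]cLj.
  by apply: eq_bigr => i _; rewrite mxE innerZl.
have x0 : x <> 0.
  move=> /w_free c_eq0; move/eqP: c0; apply; apply/rowP => j; rewrite c_eq0.
  by rewrite mxE.
have xgt0 := rnorm_gt0 x0; pose y := (rnorm x)^-1%:C *: x.
have yy : inner y y = 1.
  rewrite inner_rnorm rnormZ ger0_norm ?invr_ge0 ?rnorm_ge0//.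
  by rewrite mulVf ?lt0r_neq0// expr1n.
have yu j : inner y (u j) = 0 by rewrite innerZl xu mulr0.
pose u' (i : 'I_k.+1) := oapp u y (unlift ord_max i).
exists u'; split=> [i j|i|i]; rewrite /u'.
- case: unliftP => [i' ->|->]; case: unliftP => [j' ->|->] /=.
  + by rewrite onu (inj_eq lift_inj).
  + by rewrite innerC yu conjC0 eq_sym (negbTE (neq_lift _ _)).
  + by rewrite yu (negbTE (neq_lift _ _)).
  + by rewrite yy eqxx.
- by case: unliftP => [i' _|_] //=; rewrite (opZ linT) Tx scaler0.
- case: unliftP => [i' _|_] //=; exists (fun j => (rnorm x)^-1%:C * c 0 j).
  by rewrite /y scaler_sumr; apply: eq_bigr => j _; rewrite scalerA.
Qed.

End kernel.

(** * Spectral measures *)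

Lemma integrable_cst d (X : measurableType d) (R : realType)
    (mu : {measure set X -> \bar R}) (a : R) :
  (mu setT < +oo)%E -> mu.-integrable setT (EFin \o cst a).
Proof.
move=> muT; apply/integrableP; split.
  exact/measurable_realfun.measurable_EFinP/measurable_cst.
rewrite (eq_integral (cst `|a|%:E))// integral_cst//.
by rewrite lte_mul_pinfty// lee_fin.
Qed.

(** Source of all the strict inequalities: were the integral zero, [f] would vanish almost
    everywhere on [A], so [A] would be null. *)
Lemma Rintegral_gt0 d (X : measurableType d) (R : realType)
    (mu : {measure set X -> \bar R}) (A : set X) (f : X -> R) :
    measurable A -> mu.-integrable setT (EFin \o f) ->
    (forall t, A t -> 0 < f t) -> mu (~` A) = 0%E -> mu A <> 0%E ->
  0 < \int[mu]_t f t.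
Proof.
move=> mA intf f0 muCA muA.
have intA : mu.-integrable A (EFin \o f).
  by apply: (@integrableS _ _ _ mu setT A) => //; exact: measurableT.
rewrite /Rintegral (negligible_integral (N := ~` A))//; last exact: measurableC.
rewrite setTD setCK lt_neqAle fine_ge0 ?andbT; last first.
  by apply: integral_ge0 => t At; rewrite lee_fin ltW// f0.
rewrite eq_sym fine_eq0 ?integrable_fin_num//; apply/eqP => int0.
have : (\int[mu]_(t in A) `|(f t)%:E|)%E = 0%E.
  rewrite -[RHS]int0; apply: eq_integral => t /set_mem At.
  by rewrite /= gtr0_norm// f0.
move/ae_eq_integral_abs => /(_ mA (measurable_int _ intA))[N [mN muN AN]].
apply: muA; apply/eqP; rewrite eq_le measure_ge0 andbT -muN le_measure ?inE//.
move=> t At; apply: AN => /= /(_ At) [] ft0; have := f0 t At.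
by rewrite ft0 ltxx.
Qed.

Section spectral.
Context {R : realType} {H : hilbertType R}.
Implicit Types (x y z : H).

Section projections.
Context {P : H -> H} (projP : orthogonal_projection P).

Lemma proj_linear : linear P.
Proof. by case: projP => -[]. Qed.

Lemma orthoprojK x : P (P x) = P x.
Proof. by case: projP => _ + _ => /(congr1 (@^~ x)). Qed.

Lemma proj_sym x y : inner (P x) y = inner x (P y).
Proof. by case: projP. Qed.

Lemma proj_sqrnorm x : complex.Re (inner (P x) x) = rnorm (P x) ^+ 2.
Proof. by rewrite -rinner_rnorm /rinner [in RHS]proj_sym orthoprojK proj_sym. Qed.

End projections.

Context {S : H -> H} {E : set R -> H -> H}.
Hypotheses (linS : linear S) (SE : is_spectral_measure S E).

Let projE A : measurable A -> orthogonal_projection (E A).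
Proof. by case: SE => + _ _ _; exact. Qed.

Let EI A B x : measurable A -> measurable B -> E (A `&` B) x = E A (E B x).
Proof. by move=> mA mB; case: SE => _ _ -> . Qed.

Lemma spectral_measure_point x : exists mu : {measure set (measurableTypeR R) -> \bar R},
  [/\ forall A, measurable A -> mu A = (rnorm (E A x) ^+ 2)%:E,
      mu.-integrable setT (fun t => t%:E), mu setT = (rnorm x ^+ 2)%:E
    & inner (S x) x = (\int[mu]_t t)%:C].
Proof.
have [_ ET _ /(_ x)[mu [muE intmu Smu]]] := SE; exists mu; split=> //.
  by move=> A mA; rewrite muE// proj_sqrnorm//; exact: projE.
by rewrite muE// ET -/(rinner _ _) rinner_rnorm.
Qed.

Let E0 x : E set0 x = 0.
Proof.
have [mu [muE _ _ _]] := spectral_measure_point x.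
have /esym := muE set0 measurable0; rewrite measure0 => -[/eqP].
by rewrite sqrf_eq0 => /eqP/rnorm_eq0.
Qed.

Let ECE A x : measurable A -> E (~` A) (E A x) = 0.
Proof. by move=> mA; rewrite -EI//; [rewrite setICl E0|exact: measurableC]. Qed.

Let EEC A x : measurable A -> E A (E (~` A) x) = 0.
Proof. by move=> mA; rewrite -EI//; [rewrite setICr E0|exact: measurableC]. Qed.

(** Additivity is given only for the scalar measures. It yields [|x|^2 = |p|^2 + |q|^2]; as [p] and
    [q] are orthogonal, with [Re <p, x> = |p|^2] and likewise for [q], expanding gives
    [|x - (p + q)|^2 = 0]. *)
Let EC A x : measurable A -> x = E A x + E (~` A) x.
Proof.
move=> mA; have mCA := measurableC mA; set p := E A x; set q := E (~` A) x.
have [mu [muE _ muT _]] := spectral_measure_point x.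
have pq : rnorm x ^+ 2 = rnorm p ^+ 2 + rnorm q ^+ 2.
  apply/EFin_inj; rewrite EFinD -muT -!muE// -measureU ?setUv//.
  exact: setICr.
apply/subr0_eq/rnorm_eq0/eqP; rewrite -sqrf_eq0 sqrnormB sqrnormD.
have -> : rinner p q = 0 by rewrite /rinner proj_sym ?EEC ?inner0r//; exact: projE.
rewrite rinnerC rinnerDl /rinner !proj_sqrnorm ?pq; [|exact: projE..].
by apply/eqP; rewrite -/p -/q; ring.
Qed.

(** The measure of [x] is the sum of those of [p] and [q], because [E B p] and [E B q] are
    orthogonal for every Borel set [B]. *)
Let quadE A x : measurable A ->
  inner (S x) x = inner (S (E A x)) (E A x) + inner (S (E (~` A) x)) (E (~` A) x).
Proof.
move=> mA; have mCA := measurableC mA; set p := E A x; set q := E (~` A) x.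
have [mu [muE intmu muT ->]] := spectral_measure_point x.
have [mp [mpE intmp mpT ->]] := spectral_measure_point p.
have [mq [mqE intmq mqT ->]] := spectral_measure_point q.
rewrite -rmorphD /=; congr (_%:C); rewrite /Rintegral.
rewrite (@eq_measure_integral _ _ _ _ (measure_add mp mq)).
  rewrite integral_measure_add//; first by rewrite fineD// integrable_fin_num.
move=> B mB _; rewrite [RHS](measure_addE mp mq B) muE// mpE// mqE// -EFinD; congr (_%:E).
rewrite [x in LHS](EC x mA) (opD (proj_linear (projE mB))) sqrnormD.
rewrite (_ : rinner _ _ = 0) ?mulr0 ?addr0//.
rewrite /rinner proj_sym; last exact: projE.
rewrite orthoprojK; last exact: projE.
rewrite -EI// setIC EI// -proj_sym; last exact: projE.
by rewrite ECE// inner0l.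
Qed.

Let nullC A x : measurable A -> E A x = x -> E (~` A) x = 0.
Proof. by move=> mA Ax; rewrite -Ax ECE. Qed.

(** For [q] in the complementary range, [quadE] at [x + q] leaves [<S x, q> + <S q, x> = 0]. Putting
    ['i *: q] for [q] reverses the relative sign, so [<S x, q> = 0]. *)
Lemma spectral_proj_stable A x : measurable A -> E A x = x -> E A (S x) = S x.
Proof.
move=> mA Ax; have mCA := measurableC mA.
suff QS : E (~` A) (S x) = 0 by rewrite [RHS](EC _ mA) QS addr0.
have cross y : inner (S x) (E (~` A) y) + inner (S (E (~` A) y)) x = 0.
  set q := E (~` A) y.
  have e1 : E A (x + q) = x by rewrite (opD (proj_linear (projE mA))) Ax EEC// addr0.
  have e2 : E (~` A) (x + q) = q.
    rewrite (opD (proj_linear (projE mCA))) nullC// orthoprojK ?add0r//; exact: projE.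
  have := quadE (x + q) mA; rewrite e1 e2 (opD linS) !innerDl !innerDr.
  by move=> /eqP; rewrite -subr_eq0 => /eqP E1; rewrite -[RHS]E1; ring.
apply: innerI => y; rewrite inner0r innerC.
rewrite proj_sym; last exact: projE.
suff -> : inner (S x) (E (~` A) y) = 0 by rewrite conjC0.
have := cross ('i *: y); have := cross y.
rewrite (opZ (proj_linear (projE mCA))) (opZ linS) innerZl innerZr.
case: (inner _ _) => a b; case: (inner _ _) => c d.
move=> /eqP; rewrite eq_complex /= => /andP[/eqP h1 /eqP h2].
move=> /eqP; rewrite eq_complex /= => /andP[/eqP h3 /eqP h4].
by apply/eqP; rewrite eq_complex /=; apply/andP; split; apply/eqP; lra.
Qed.

(** Integrate [t - a] against the measure of [x], which has mass [|x|^2], all of it on [A]. *)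
Lemma quad_form_gt A (a : R) x : measurable A -> E A x = x -> x <> 0 ->
  (forall t, A t -> a < t) -> a * rnorm x ^+ 2 < rinner (S x) x.
Proof.
move=> mA Ax x0 Aa; have [mu [muE intmu muT Smu]] := spectral_measure_point x.
have intc : mu.-integrable setT (EFin \o cst a).
  by apply: integrable_cst; rewrite muT ltry.
have := @Rintegral_gt0 _ _ _ mu A (fun t => t - a) mA.
rewrite RintegralB// Rintegral_cst// muT /rinner Smu /= subr_gt0; apply.
- have -> : EFin \o (fun t => t - a) = ((fun t => t%:E) \- (EFin \o cst a))%E by apply/funext => t.
  exact: (integrableB measurableT intmu intc).
- by move=> t /Aa; rewrite subr_gt0.
- by rewrite muE ?nullC ?rnorm0 ?expr0n//; exact: measurableC.
- by rewrite muE// Ax => -[/eqP]; rewrite sqrf_eq0 => /eqP/rnorm_eq0.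
Qed.

Lemma quad_form_lt A (b : R) x : measurable A -> E A x = x -> x <> 0 ->
  (forall t, A t -> t < b) -> rinner (S x) x < b * rnorm x ^+ 2.
Proof.
move=> mA Ax x0 Ab; have [mu [muE intmu muT Smu]] := spectral_measure_point x.
have intc : mu.-integrable setT (EFin \o cst b).
  by apply: integrable_cst; rewrite muT ltry.
have := @Rintegral_gt0 _ _ _ mu A (fun t => b - t) mA.
rewrite RintegralB// Rintegral_cst// muT /rinner Smu /= subr_gt0; apply.
- have -> : EFin \o (fun t => b - t) = ((EFin \o cst b) \- (fun t => t%:E))%E by apply/funext => t.
  exact: (integrableB measurableT intc intmu).
- by move=> t /Ab; rewrite subr_gt0.
- by rewrite muE ?nullC ?rnorm0 ?expr0n//; exact: measurableC.
- by rewrite muE// Ax => -[/eqP]; rewrite sqrf_eq0 => /eqP/rnorm_eq0.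
Qed.

(* [(b - a) (S - a) (b - S) = (S - a) (b - S) (S - a) + (b - S) (S - a) (b - S)],
   and [S] preserves the range of [E A], where [a < S < b]. *)
Lemma quad_form_interval A (a b : R) x : measurable A -> E A x = x -> x <> 0 ->
    (forall y z, rinner (S y) z = rinner y (S z)) ->
    a < b -> (forall t, A t -> a < t < b) ->
  a * b * rnorm x ^+ 2 < (a + b) * rinner (S x) x - rnorm (S x) ^+ 2.
Proof.
move=> mA Ax x0 symS ab Aab.
have gt_a y : E A y = y -> y <> 0 -> 0 < rinner (S y - a%:C *: y) y.
  move=> Ay y0; rewrite !rinnerE rinner_rnorm subr_gt0 (quad_form_gt mA)// => t.
  by move=> /Aab/andP[].
have lt_b y : E A y = y -> y <> 0 -> 0 < rinner (b%:C *: y - S y) y.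
  move=> Ay y0; rewrite !rinnerE rinner_rnorm subr_gt0 (quad_form_lt mA)// => t.
  by move=> /Aab/andP[].
have EA := proj_linear (projE mA).
have ES := spectral_proj_stable mA Ax.
pose u := S x - a%:C *: x; pose v := b%:C *: x - S x.
have Au : E A u = u by rewrite /u (opB EA) (opZ EA) ES Ax.
have Av : E A v = v by rewrite /v (opB EA) (opZ EA) ES Ax.
have u0 : u <> 0.
  by move=> u0; have := gt_a x Ax x0; rewrite -/u u0 /rinner inner0l ltxx.
have uv_gt0 : 0 < rinner (b%:C *: u - S u) u + rinner (S v - a%:C *: v) v.
  have [->|v0] := pselect (v = 0); last by rewrite addr_gt0 ?lt_b ?gt_a.
  by rewrite [X in _ + X]/rinner inner0r addr0 lt_b.
move: uv_gt0; rewrite /u /v !(opB linS) !(opZ linS) !rinnerE.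
rewrite !(symS (S x)) !rinner_rnorm !(rinnerC x) => uv_gt0.
have : 0 < (b - a) * ((a + b) * rinner (S x) x - rnorm (S x) ^+ 2 - a * b * rnorm x ^+ 2).
  by move: uv_gt0; congr (0 < _); ring.
by rewrite pmulr_rgt0 ?subr_gt0.
Qed.

End spectral.

(** * Rank bounds *)

Lemma kappa_ge0 (R : realType) (r : R) : 0 <= kappa r.
Proof. by rewrite /kappa le_max lexx. Qed.

(** [k < r <= ceil r] between integers leaves room for the [- 1]. *)
Lemma kappa_ge (R : realType) (r : R) (k : nat) : k%:R < r -> k%:Z <= kappa r.
Proof.
move=> kr; rewrite /kappa le_max lerBrDr lezD1 -(@ltr_int R).
by rewrite (lt_le_trans kr) ?orbT// ceil_ge.
Qed.

Section rank_bounds.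
Context {R : realType}.
Implicit Types H G : hilbertType R.

Lemma op_rank_leP H G (T : H -> G) (N : nat) : (op_rank T <= (N%:R)%:E)%E ->
  forall m (v : 'I_m -> H), lin_free (T \o v) -> (m <= N)%N.
Proof.
move=> TN m v Tv; rewrite -(@ler_nat R) -lee_fin; apply: le_trans TN.
by apply: ereal_sup_ubound; exists m => //; exists v.
Qed.

(* A subspace of [range P] of dimension [N + k] meets [ker L] in dimension at
   least [k]; summing the lower bound over an orthonormal basis of this
   intersection gives [k * c < hs_normsq T]. *)
Lemma op_rank_le H G (P : H -> H) (L T : H -> G) (N : nat) (c : R) :
    linear P -> (forall x, P (P x) = P x) ->
    linear L -> (op_rank L <= (N%:R)%:E)%E ->
    bounded_op T -> (hs_normsq T < +oo)%E -> 0 < c ->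
    (forall x, P x = x -> L x = 0 -> x <> 0 -> c * rnorm x ^+ 2 < rnorm (T x) ^+ 2) ->
  (op_rank P <= ((N%:Z + kappa (fine (hs_normsq T) / c))%:~R)%:E)%E.
Proof.
move=> linP PP linL rkL bT hsT c0 cT.
apply: ge_ereal_sup => _ [n [v Pv] <-]; rewrite lee_fin -[n%:R]/(n%:Z%:~R) ler_int.
have [nN|Nn] := leqP n N.
  by apply: (@le_trans _ _ N%:Z); rewrite ?lez_nat// lerDl kappa_ge0.
have [u [onu Lu wu]] := orthonormal_in_kernel linL (op_rank_leP rkL) Pv
  (eq_leq (subnK (ltnW Nn))).
suff kn : (n - N)%:R < fine (hs_normsq T) / c.
  by have := kappa_ge kn; rewrite -subzn ?(ltnW Nn)// lerBlDl.
rewrite ltr_pdivlMr//.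
have u1 i : rnorm (u i) ^+ 2 = 1 by rewrite -rinner_rnorm /rinner onu eqxx.
have u0 i : u i <> 0.
  by move=> ui; have /eqP := u1 i; rewrite ui rnorm0 expr0n eq_sym oner_eq0.
have Pu i : P (u i) = u i.
  have [a ->] := wu i; rewrite (op_sum linP); apply: eq_bigr => j _.
  by rewrite (opZ linP) /= PP.
have hs_fin : hs_normsq T \is a fin_num.
  rewrite ge0_fin_numE// esum_ge0// => e _.
  by rewrite lee_fin sqrnormE sqr_ge0.
rewrite -lte_fin fineK//; apply: lt_le_trans (sum_sqnorm_le_hs bT onu).
rewrite lte_fin mulr_natl -[X in _ *+ X]card_ord -sumr_const.
(* Since [N < n] the family is nonempty: one term gives strictness, and the weak bound is enough for
   the others. *)
have i0 : 'I_(n - N) by apply: (@Ordinal _ 0); rewrite subn_gt0.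
rewrite (bigD1 i0)//= [ltRHS](bigD1 i0)//= ltr_leD//.
  by have := cT _ (Pu i0) (Lu i0) (u0 i0); rewrite u1 mulr1.
apply: ler_sum => i _.
by have := cT _ (Pu i) (Lu i) (u0 i); rewrite u1 mulr1 => /ltW.
Qed.

(* The default value covers the case without spectral measure, so that the
   spectral theorem is not needed. *)
Lemma spectral_measureP H (S : H -> H) :
  is_spectral_measure S (spectral_measure S) \/ forall A x, spectral_measure S A x = 0.
Proof. by rewrite /spectral_measure; case: xgetP => [E _ SE|_]; [left|right]. Qed.

Lemma spectral_proj_linear H (S : H -> H) (A : set R) :
  measurable A -> linear (spectral_proj A S).
Proof.
move=> mA; have [[SE _ _ _]|S0] := spectral_measureP S.
  exact: (proj_linear (SE A mA)).
by move=> a x y; rewrite /spectral_proj !S0 scaler0 addr0.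
Qed.

Lemma spectral_projK H (S : H -> H) (A : set R) x : measurable A ->
  spectral_proj A S (spectral_proj A S x) = spectral_proj A S x.
Proof.
move=> mA; have [[SE _ _ _]|S0] := spectral_measureP S.
  exact: (orthoprojK (SE A mA) x).
by rewrite /spectral_proj !S0.
Qed.

(** Under the default value every projection is zero. A nonzero fixed vector therefore brings the
    spectral properties exactly where the rank estimate calls for them. *)
Lemma spectral_proj_fixed H (S : H -> H) (A : set R) x :
  spectral_proj A S x = x -> x <> 0 -> is_spectral_measure S (spectral_measure S).
Proof.
by have [//|S0] := spectral_measureP S; rewrite /spectral_proj S0 => <-.
Qed.

End rank_bounds.

(** * The operators [K^* K] and [I - K K^*] of a contraction *)

Section contraction.
Context {R : realType} {H G : hilbertType R} {K : H -> G}.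
Hypothesis cK : contraction_op K.

Let bK : bounded_op K := contraction_bounded cK.
Let S := adjoint K \o K.
Let A := idfun \- (K \o adjoint K).

Lemma linear_gram : linear S.
Proof. by move=> a x y; rewrite /S /= (proj1 bK) (adjoint_linear bK). Qed.

Lemma gram_sym x y : rinner (S x) y = rinner x (S y).
Proof. by rewrite /rinner adjoint_inner// adjointP. Qed.

Lemma rinner_gram x : rinner (S x) x = rnorm (K x) ^+ 2.
Proof. by rewrite /rinner adjoint_inner// -/(rinner _ _) rinner_rnorm. Qed.

Lemma op_sqrt_defect :
  [/\ bounded_op (op_sqrt A), positive_op (op_sqrt A) & op_sqrt A \o op_sqrt A = A].
Proof.
have cC : contraction_op (K \o adjoint K).
  have [linK K1] := cK; have [linKa Ka1] := adjoint_contraction cK.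
  split=> [a x y|x]; first by rewrite /= linKa linK.
  exact: le_trans (K1 _) (Ka1 _).
have symC x y : inner ((K \o adjoint K) x) y = inner x ((K \o adjoint K) y).
  by rewrite /= adjointP// adjoint_inner.
have [W WP] := sqrt_id_sub_exists cC symC.
apply: (@xgetPex _ (fun=> 0)
  [set B | [/\ bounded_op B, positive_op B & B \o B = A]]).
by exists W.
Qed.

End contraction.

(** Polarization: reality of [<W z, z>] at [x + y] matches the imaginary parts of [<W x, y>] and
    [<x, W y>], and at [x + 'i *: y] their real parts. *)
Lemma positive_op_sym (R : realType) (H : hilbertType R) (W : H -> H) :
  linear W -> positive_op W -> forall x y, inner (W x) y = inner x (W y).
Proof.
move=> linW posW x y.
have Wsym z : complex.Im (inner (W z) z) = 0 by apply: ger0_Im.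
have := Wsym (x + y); have := Wsym (x + 'i *: y); have := Wsym x; have := Wsym y.
rewrite !(opD linW) (opZ linW) !innerDl !innerDr !innerZl !innerZr.
rewrite (innerC x (W y)).
case: (inner (W y) y) => y1 y2; case: (inner (W x) x) => x1 x2.
case: (inner (W x) y) => a b; case: (inner (W y) x) => c d /= h1 h2 h3 h4.
apply/eqP; rewrite eq_complex /=; apply/andP; split; apply/eqP; lra.
Qed.

Section defect_bounds.
Context {R : realType} {H G : hilbertType R} {K : H -> G}.
Hypothesis cK : contraction_op K.

Let bK : bounded_op K := contraction_bounded cK.
Let S := adjoint K \o K.
Let A := idfun \- (K \o adjoint K).
Let W := op_sqrt A.

(** By symmetry [|W y|^2 = <y, W^2 y>]. The trace formula and [d_N <= e_N] follow, and [y = K x]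
    gives [|W K x|^2 = <S x, x> - |S x|^2]. *)
Lemma sqrnorm_sqrt_defect y : rnorm (W y) ^+ 2 = rnorm y ^+ 2 - rnorm (adjoint K y) ^+ 2.
Proof.
have [[linW _] posW WW] := op_sqrt_defect cK.
rewrite -rinner_rnorm /rinner (positive_op_sym linW posW).
rewrite -[op_sqrt _ (_ y)]/((W \o W) y) WW /= innerBr inner_rnorm.
by rewrite -adjoint_inner// inner_rnorm.
Qed.

Lemma inner_defect (D : H -> G) x : bounded_op D ->
  complex.Re (inner ((adjoint D \o A \o D) x) x) = rnorm (W (D x)) ^+ 2.
Proof.
move=> bD; rewrite sqrnorm_sqrt_defect /= adjoint_inner// innerBl inner_rnorm.
by rewrite (adjointP bK) inner_rnorm.
Qed.

Lemma hs_defect_le (D : H -> G) : (hs_normsq (W \o D) <= hs_normsq D)%E.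
Proof.
apply: le_esum => e _; rewrite lee_fin !sqrnormE /= sqrnorm_sqrt_defect.
by rewrite gerBl sqr_ge0.
Qed.

Context {KN : H -> G} {N : nat} {eps : R}.
Hypotheses (bKN : bounded_op KN) (rkKN : (op_rank KN <= (N%:R)%:E)%E)
  (hsD : hilbert_schmidt (K \- KN)) (eps_gt0 : 0 < eps).

(** [B] is left free to serve both []eps, +oo[] for [Qrank] and []eps, 1 - eps[] for the first bound
    on [Lambda]. *)
Lemma spectral_rank_le B : measurable B -> (forall t, B t -> eps < t) ->
  (op_rank (spectral_proj B S) <=
    ((N%:Z + kappa (fine (hs_normsq (K \- KN)) / eps))%:~R)%:E)%E.
Proof.
move=> mB Beps; have [bD hD] := hsD.
apply: (op_rank_le (L := KN)) => //.
- exact: spectral_proj_linear.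
- by move=> x; apply: spectral_projK.
- by case: bKN.
move=> x Bx Lx x0 /=; rewrite Lx subr0 -(rinner_gram cK).
exact: (quad_form_gt (spectral_proj_fixed Bx x0) mB Bx x0 Beps).
Qed.

Lemma spectral_rank_defect_le B : eps < 1 / 2 ->
  measurable B -> (forall t, B t -> eps < t < 1 - eps) ->
  (op_rank (spectral_proj B S) <=
    ((N%:Z + kappa (fine (hs_normsq (W \o (K \- KN))) / (eps * (1 - eps))))%:~R)%:E)%E.
Proof.
move=> eps_lt mB Beps; have [bD hD] := hsD; have [bW _ _] := op_sqrt_defect cK.
apply: (op_rank_le (L := KN)) => //.
- exact: spectral_proj_linear.
- by move=> x; apply: spectral_projK.
- by case: bKN.
- exact: bounded_op_comp.
- exact: le_lt_trans (hs_defect_le _) hD.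
- by rewrite mulr_gt0// subr_gt0; lra.
move=> x Bx Lx x0 /=; rewrite Lx subr0 sqrnorm_sqrt_defect.
(* With endpoints [eps] and [1 - eps] the coefficient [a + b] is 1, which leaves exactly
   [S - S^2]. *)
have := quad_form_interval (linear_gram cK) (spectral_proj_fixed Bx x0) mB Bx x0
  (gram_sym cK) _ Beps.
by rewrite (rinner_gram cK) (addrC eps) subrK mul1r; apply; lra.
Qed.

End defect_bounds.

Unset Implicit Arguments.

Theorem theorem2p5 (R : realType) (H G : hilbertType R) (K : H -> G) (eps : R)
    (sepH : separable H) (sepG : separable G) (hK : contraction_op K)
    (eps_gt0 : 0 < eps) (eps_lt : eps < 1 / 2) :
  let S : H -> H := adjoint K \o K in
  let A : G -> G := idfun \- (K \o adjoint K) in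
  let W : G -> G := op_sqrt A in
  let available (N : nat) (KN : H -> G) : Prop :=
    [/\ bounded_op KN, (op_rank KN <= (N%:R)%:E)%E
      & hilbert_schmidt (K \- KN)] in
  let e2 (KN : H -> G) : \bar R := hs_normsq (K \- KN) in
  let d2 (KN : H -> G) : \bar R := hs_normsq (W \o (K \- KN)) in
  let boundQ (N : nat) (KN : H -> G) : int :=
    N%:Z + kappa (fine (e2 KN) / eps) in
  let boundL (N : nat) (KN : H -> G) : int :=
    Num.min (N%:Z + kappa (fine (e2 KN) / eps))
            (N%:Z + kappa (fine (d2 KN) / (eps * (1 - eps)))) in
  (forall (N : nat) (KN : H -> G), available N KN ->
    [/\ (Qrank eps S <= ((boundQ N KN)%:~R)%:E)%E,
        (Lambda eps S <= ((boundL N KN)%:~R)%:E)%E,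
        d2 KN = trace_pos (adjoint (K \- KN) \o A \o (K \- KN))
      & (d2 KN <= e2 KN)%E ]) /\
  (Qrank eps S <=
     ereal_inf [set ((boundQ p.1 p.2)%:~R)%:E | p in
       [set p : nat * (H -> G) | available p.1 p.2]])%E /\
  (Lambda eps S <=
     ereal_inf [set ((boundL p.1 p.2)%:~R)%:E | p in
       [set p : nat * (H -> G) | available p.1 p.2]])%E.
Proof.
move=> S A W available e2 d2 boundQ boundL.
have main N KN : available N KN ->
    [/\ (Qrank eps S <= ((boundQ N KN)%:~R)%:E)%E,
        (Lambda eps S <= ((boundL N KN)%:~R)%:E)%E,
        d2 KN = trace_pos (adjoint (K \- KN) \o A \o (K \- KN))
      & (d2 KN <= e2 KN)%E ].
  move=> [bKN rkKN hsD]; split.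
  - apply: (spectral_rank_le hK bKN rkKN hsD eps_gt0) => [|t].
      exact: measurable_itv.
    by rewrite /= in_itv /= andbT.
  - rewrite /boundL; case: (leP (N%:Z + kappa (fine (e2 KN) / eps))) => _.
      apply: (spectral_rank_le hK bKN rkKN hsD eps_gt0) => [|t].
        exact: measurable_itv.
      by rewrite /= in_itv /= => /andP[].
    apply: (spectral_rank_defect_le hK bKN rkKN hsD eps_gt0 eps_lt) => [|t].
      exact: measurable_itv.
    by rewrite /= in_itv.
  (* Both sides are sums over the same [onb H] and agree term by term. *)
  - apply: eq_esum => e _; rewrite sqrnormE (inner_defect hK)//.
    by case: hsD.
  - exact: (hs_defect_le hK).
split=> //; split; apply: le_ereal_inf_tmp => _ [[N KN] /= /main[hQ hL _ _] <-] //.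
Qed.
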